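(* Let $H=KQ/I$ where $Q$ is the quiver with two vertices $1,2$, one arrow $\alpha\colon 2\to 1$ and one loop $\varepsilon\colon 1\to1$, and $I=\langle\varepsilon^4\rangle$. Let $V\in\mathrm{mod}(H)$ be $\partial$-stable. Then $V\cong\bar V_\infty$ or $V\cong V_\lambda$ for some $\lambda\in K$, where $\bar V_\infty$ is given by $\bar V_\infty(2)=K$, $\bar V_\infty(1)=K^2$, $$\bar V_\infty(\alpha)=\begin{pmatrix}1\\0\end{pmatrix},\qquad \bar V_\infty(\varepsilon)=\begin{pmatrix}0&0\\1&0\end{pmatrix},$$ and $V_\lambda$ is given by $V_\lambda(2)=K^2$, $V_\lambda(1)=K^4$, $$V_\lambda(\alpha)=\begin{pmatrix}1&0\\0&1\\0&\lambda\\0&0\end{pmatrix},\qquad V_\lambda(\varepsilon)=\begin{pmatrix}0&0&0&0\\1&0&0&0\\0&1&0&0\\0&0&1&0\end{pmatrix}.$$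
   Context: $K$ is an algebraically closed field of characteristic $0$; modules are finite-dimensional left $H$-modules, identified with representations of $Q$ satisfying the relation. The algebra $H$ is the GLS algebra of affine type $\widetilde{\mathrm{BC}}_1$ with minimal symmetrizer $\mathrm{diag}(4,1)$. The defect is the linear form $\partial(V)=-\dim V(1)+2\dim V(2)$. A non-zero module $V$ is $\partial$-stable if $\partial(V)=0$ and $\partial(U)<0$ for every proper non-zero submodule $U\subset V$. *)

(* Defs.v *)
From mathcomp Require Import all_boot all_order all_algebra.

Set Implicit Arguments.
Unset Strict Implicit.
Unset Printing Implicit Defensive.

Import Order.TTheory GRing.Theory Num.Theory.
Local Open Scope ring_scope.

(* Finite-dimensional modules over H = KQ / (eps^4), where Q has vertices 1, 2,
   an arrow alpha : 2 -> 1 and a loop eps : 1 -> 1, as representations of Q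
   satisfying the relation. *)
Record hmod (K : fieldType) := HMod {
  sp1 : vectType K;
  sp2 : vectType K;
  alpha : 'Hom(sp2, sp1);
  eps : 'End(sp1);
  eps_nilp : forall x : sp1, iter 4 eps x = 0
}.

Record submodule (K : fieldType) (V : hmod K) := Submodule {
  sub1 : {vspace sp1 V};
  sub2 : {vspace sp2 V};
  sub_alpha : (alpha V @: sub2 <= sub1)%VS;
  sub_eps : (eps V @: sub1 <= sub1)%VS
}.

Definition hmod_iso (K : fieldType) (V W : hmod K) : Prop :=
  exists (f1 : 'Hom(sp1 V, sp1 W)) (f2 : 'Hom(sp2 V, sp2 W)),
    [/\ bijective f1, bijective f2,
        forall x : sp2 V, f1 (alpha V x) = alpha W (f2 x)
      & forall x : sp1 V, f1 (eps V x) = eps W (f1 x)].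

Definition nonzero_hmod (K : fieldType) (V : hmod K) : Prop :=
  ~ (\dim {:sp1 V} = 0%N /\ \dim {:sp2 V} = 0%N).

Definition nonzero_sub (K : fieldType) (V : hmod K) (U : submodule V) : Prop :=
  ~ (sub1 U = 0%VS /\ sub2 U = 0%VS).

Definition proper_sub (K : fieldType) (V : hmod K) (U : submodule V) : Prop :=
  ~ (sub1 U = fullv /\ sub2 U = fullv).

(* The defect as a linear form on dimension vectors (d1, d2). *)
Definition defect (d1 d2 : nat) : int := - d1%:Z + 2 * d2%:Z.

Definition hmod_defect (K : fieldType) (V : hmod K) : int :=
  defect (\dim {:sp1 V}) (\dim {:sp2 V}).

Definition sub_defect (K : fieldType) (V : hmod K) (U : submodule V) : int :=
  defect (\dim (sub1 U)) (\dim (sub2 U)).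

Definition defect_stable (K : fieldType) (V : hmod K) : Prop :=
  [/\ nonzero_hmod V,
      hmod_defect V = 0
    & forall U : submodule V,
        proper_sub U -> nonzero_sub U -> sub_defect U < 0].

Definition mx_of_rows (K : fieldType) (m n : nat) (rows : seq (seq K)) :
  'M[K]_(m, n) := \matrix_(i < m, j < n) (nth [::] rows i)`_j.

(* Matrices act on column vectors from the left. *)
Definition mxlin (K : fieldType) (m n : nat) (A : 'M[K]_(m, n)) :
  'Hom('cV[K]_n, 'cV[K]_m) := linfun (mulmx A).

Definition alpha_inf_mx (K : fieldType) : 'M[K]_(2, 1) :=
  mx_of_rows 2 1 [:: [:: 1];
                     [:: 0]].

Definition eps_inf_mx (K : fieldType) : 'M[K]_2 :=
  mx_of_rows 2 2 [:: [:: 0; 0];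
                     [:: 1; 0]].

Definition alpha_lambda_mx (K : fieldType) (lambda : K) : 'M[K]_(4, 2) :=
  mx_of_rows 4 2 [:: [:: 1; 0];
                     [:: 0; 1];
                     [:: 0; lambda];
                     [:: 0; 0]].

Definition eps_lambda_mx (K : fieldType) : 'M[K]_4 :=
  mx_of_rows 4 4 [:: [:: 0; 0; 0; 0];
                     [:: 1; 0; 0; 0];
                     [:: 0; 1; 0; 0];
                     [:: 0; 0; 1; 0]].

Lemma eps_inf_nilp (K : fieldType) (x : 'cV[K]_2) :
  iter 4 (mxlin (eps_inf_mx K)) x = 0.
Proof.
rewrite /= !lfunE /= !mulmxA (_ : eps_inf_mx K *m _ = 0) ?mul0mx //.
apply/matrixP=> i j; rewrite !mxE !big_ord_recl big_ord0 !mxE.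
by case: i => [[|[|//]] ?]; case: j => [[|[|//]] ?];
  rewrite /= ?(mul0r, mulr0, addr0).
Qed.

Lemma eps_lambda_nilp (K : fieldType) (x : 'cV[K]_4) :
  iter 4 (mxlin (eps_lambda_mx K)) x = 0.
Proof.
have sqr : eps_lambda_mx K *m eps_lambda_mx K =
    mx_of_rows 4 4 [:: [:: 0; 0; 0; 0]; [:: 0; 0; 0; 0];
                       [:: 1; 0; 0; 0]; [:: 0; 1; 0; 0]].
  apply/matrixP=> i j; rewrite !mxE !big_ord_recl big_ord0 !mxE.
  by case: i => [[|[|[|[|//]]]] ?]; case: j => [[|[|[|[|//]]]] ?];
    rewrite /= ?(mul0r, mulr0, mul1r, add0r, addr0).
have sqr0 : eps_lambda_mx K *m eps_lambda_mx K
    *m (eps_lambda_mx K *m eps_lambda_mx K) = 0.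
  rewrite sqr; apply/matrixP=> i j; rewrite !mxE !big_ord_recl big_ord0 !mxE.
  by case: i => [[|[|[|[|//]]]] ?]; case: j => [[|[|[|[|//]]]] ?];
    rewrite /= ?(mul0r, mulr0, addr0).
by rewrite /= !lfunE /= !mulmxA; move: sqr0; rewrite !mulmxA => ->; rewrite mul0mx.
Qed.

Definition V_inf (K : fieldType) : hmod K :=
  @HMod K 'cV[K]_2 'cV[K]_1
    (mxlin (alpha_inf_mx K)) (mxlin (eps_inf_mx K)) (@eps_inf_nilp K).

Definition V_lambda (K : fieldType) (lambda : K) : hmod K :=
  @HMod K 'cV[K]_4 'cV[K]_2
    (mxlin (alpha_lambda_mx lambda)) (mxlin (eps_lambda_mx K))
    (@eps_lambda_nilp K).

(* Main.v *)
From HB Require Import structures.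
Require Import Defs.
From mathcomp Require Import all_boot all_order all_algebra.

(** Write n for the dimension of V(2), so that V(1) has dimension 2n, and
    a = alpha, e = eps. Stability is used in a single form
    ([stable_span_basis]): as soon as vectors of V(1) and independent vectors
    of V(2) span a submodule whose defect is at least 0, they span all of V,
    which pins down n and turns the spanning vectors into bases. Applied to
    small submodules this gives:

    - a is injective, since a vector of its kernel spans a submodule of
      defect 2;
    - if n = 1 and w spans the image of a, then w and e w form a basis of
      V(1), and nilpotency forces e^2 w = 0: this is V_inf;
    - if n >= 2, then e^2 a is injective, since otherwise w = a x and e w
      would span, together with x, a proper submodule of defect at least 0.

    Suppose n >= 2. The images of a and of e^2 a both have dimension n, and
    they meet trivially because e^4 = 0; hence V(1) is their direct sum.
    Therefore e a x = a (N x) + e^2 a (T x) for some endomorphisms N and T of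
    V(2). As K is algebraically closed, T has an eigenvector x, say
    T x = c x; then with w = a x and y = N x,

      a y = e w - c e^2 w.

    So w, e w, e^2 w, e^3 w span, together with x and y, a submodule; x and y
    are independent because otherwise w and e^2 w would already span, together
    with x, a proper submodule of defect at least 0. Hence that submodule has
    defect at least 0 and is V itself, n = 2, and in the bases just exhibited
    V is V_lambda with lambda = - c. *)

Import GRing.Theory Num.Theory passmx.
Local Open Scope ring_scope.

Set Implicit Arguments.
Unset Strict Implicit.
Unset Printing Implicit Defensive.

(** * Modules described by matrices in chosen bases *)

Section Coordinates.

Context {K : fieldType}.

Definition coord_col (vT : vectType K) (n : nat) (X : n.-tuple vT) (v : vT) :
  'cV[K]_n := \col_i coord X i v.

Lemma coord_col_linear (vT : vectType K) n (X : n.-tuple vT) :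
  linear (coord_col X).
Proof. by move=> a u v; apply/colP=> i; rewrite !mxE linearP. Qed.

HB.instance Definition _ (vT : vectType K) n (X : n.-tuple vT) :=
  GRing.isSemilinear.Build K vT 'cV[K]_n _ (coord_col X)
    (GRing.semilinear_linear (coord_col_linear X)).

Lemma coord_col_bij (vT : vectType K) n (X : n.-tuple vT) :
  basis_of fullv X -> bijective (coord_col X).
Proof.
move=> basisX.
exists (fun c : 'cV[K]_n => \sum_i c i 0 *: X`_i) => [v | c].
  rewrite [RHS](coord_basis basisX (memvf v)).
  by apply: eq_bigr => i _; rewrite mxE.
by apply/colP=> i; rewrite mxE coord_sum_free // (basis_free basisX).
Qed.

Lemma coord_col_lfun (aT rT : vectType K) m n (X : m.-tuple rT)
    (Y : n.-tuple aT) (A : 'M[K]_(m, n)) (h : 'Hom(aT, rT)) (v : aT) :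
  basis_of fullv X -> basis_of fullv Y ->
  (forall j : 'I_n, h Y`_j = \sum_i A i j *: X`_i) ->
  coord_col X (h v) = A *m coord_col Y v.
Proof.
move=> basisX basisY hY; rewrite {1}(coord_basis basisY (memvf v)).
rewrite !linear_sum; apply/colP=> i; rewrite summxE mxE.
apply: eq_bigr => j _; rewrite !linearZ /= hY !mxE coord_sum_free //.
  by rewrite mulrC.
exact: basis_free basisX.
Qed.

(** Reduces both isomorphisms of the classification to exhibiting bases on
    which alpha and eps act by the prescribed columns. *)
Lemma hmod_iso_of_bases (V : hmod K) m n (A : 'M[K]_(m, n)) (E : 'M[K]_m)
    (nilE : forall x, iter 4 (mxlin E) x = 0)
    (X : m.-tuple (sp1 V)) (Y : n.-tuple (sp2 V)) :
  basis_of fullv X -> basis_of fullv Y ->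
  (forall j : 'I_n, alpha V Y`_j = \sum_i A i j *: X`_i) ->
  (forall j : 'I_m, eps V X`_j = \sum_i E i j *: X`_i) ->
  hmod_iso V (HMod (mxlin A) nilE).
Proof.
move=> basisX basisY alphaY epsX.
exists (linfun (coord_col X)), (linfun (coord_col Y)).
split=> [||y|x].
- by apply: (eq_bij (coord_col_bij basisX)) => v; rewrite lfunE.
- by apply: (eq_bij (coord_col_bij basisY)) => v; rewrite lfunE.
- by rewrite !lfunE /= (coord_col_lfun _ basisX basisY alphaY).
- by rewrite !lfunE /= (coord_col_lfun _ basisX basisX epsX).
Qed.

End Coordinates.

(** * Eigenvectors over an algebraically closed field *)

(** The characteristic polynomial of [f] in a basis of [vT] is not constant,
    hence has a root. *)
Lemma closed_field_eigenvector (K : closedFieldType) (vT : vectType K)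
    (f : 'End(vT)) :
  \dim {:vT} != 0%N -> exists (c : K) (v : vT), v != 0 /\ f v = c *: v.
Proof.
move=> dim_gt0; set e := vbasis {:vT}.
have basis_e : basis_of fullv e := vbasisP _.
have szp : size (char_poly (mxof e e f)) != 1%N by rewrite size_char_poly.
have [c] := closed_rootP _ szp.
rewrite -eigenvalue_root_char => /eigenvalueP[u uc u0].
exists c, (vecof e u); split.
  by rewrite (vecof_eq0 basis_e).
by rewrite (hom_vecof e basis_e) uc linearZ.
Qed.

(** * Consequences of stability *)

Section Stability.

Context {K : fieldType} {V : hmod K}.
Hypothesis stableV : defect_stable V.

Lemma stable_dim : \dim {:sp1 V} = (2 * \dim {:sp2 V})%N.
Proof.
case: stableV => _ + _; rewrite /hmod_defect /defect addrC => /eqP.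
by rewrite subr_eq0 -PoszM => /eqP[].
Qed.

Lemma stable_dim2_neq0 : \dim {:sp2 V} != 0%N.
Proof.
case: stableV => nz _ _; apply/eqP => d2.
by apply: nz; rewrite stable_dim d2.
Qed.

(** The spans form a submodule of defect at least
    2 * size s2 - size s1 >= 0, hence the whole module; a count of dimensions
    then shows that [s1], too, is free. *)
Lemma stable_span_basis (s1 : seq (sp1 V)) (s2 : seq (sp2 V)) :
  free s2 -> s2 != [::] -> (size s1 <= 2 * size s2)%N ->
  {in s2, forall y, alpha V y \in <<s1>>%VS} ->
  {in s1, forall x, eps V x \in <<s1>>%VS} ->
  basis_of fullv s1 /\ basis_of fullv s2.
Proof.
move=> free2 nil2 le12 al ep.
have sub_al : (alpha V @: <<s2>> <= <<s1>>)%VS.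
  by rewrite limg_span; apply/span_subvP=> _ /mapP[y ys ->]; apply: al.
have sub_ep : (eps V @: <<s1>> <= <<s1>>)%VS.
  by rewrite limg_span; apply/span_subvP=> _ /mapP[y ys ->]; apply: ep.
have dim2 : \dim <<s2>> = size s2 by apply/eqP.
have [/andP[/eqP full1 /eqP full2]|proper] :=
    boolP ((<<s1>>%VS == fullv) && (<<s2>>%VS == fullv)).
  have dimV2 : \dim {:sp2 V} = size s2 by rewrite -full2.
  by rewrite !basisEdim full1 full2 !subvv stable_dim dimV2 leqnn.
case: stableV => _ _ /(_ (Submodule sub_al sub_ep)) /=.
rewrite /sub_defect /defect /= dim2 addrC subr_lt0 -PoszM ltz_nat.
move=> neg; suff /leq_trans/(_ (dim_span _))/leq_trans/(_ le12) :
    (2 * size s2 < \dim <<s1>>)%N by rewrite ltnn.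
apply: neg.
- by case=> /= f1 f2; rewrite f1 f2 !eqxx in proper.
- case=> /= _ z2; move: dim2; rewrite z2 dimv0 => /esym/eqP.
  by rewrite size_eq0 (negPf nil2).
Qed.

(** A non-zero [y] killed by alpha spans a submodule of dimension vector
    (0, 1), which would be all of [V], against [stable_dim]. *)
Lemma stable_alpha_eq0 y : alpha V y = 0 -> y = 0.
Proof.
move=> ay0; apply/eqP/negPn/negP=> y0.
have [] := @stable_span_basis [::] [:: y].
- by rewrite seq1_free.
- by [].
- by [].
- by move=> z; rewrite inE => /eqP ->; rewrite ay0 mem0v.
- by [].
move=> /size_basis + /size_basis; rewrite stable_dim => + d2.
by rewrite d2.
Qed.

(** Otherwise [alpha y], [eps (alpha y)] and [y] span a submodule of defect at
    least 0, hence all of [V], so that V(2) would be a line. *)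
Lemma stable_eps2_alpha_eq0 y :
  (1 < \dim {:sp2 V})%N -> eps V (eps V (alpha V y)) = 0 -> y = 0.
Proof.
move=> d2 eey0; apply/eqP/negPn/negP=> y0.
have [] := @stable_span_basis [:: alpha V y; eps V (alpha V y)] [:: y].
- by rewrite seq1_free.
- by [].
- by [].
- by move=> z; rewrite inE => /eqP ->; apply: memv_span; rewrite mem_head.
- move=> z; rewrite !inE => /orP[] /eqP ->.
    by apply: memv_span; rewrite !inE eqxx orbT.
  by rewrite eey0 mem0v.
by move=> _ /size_basis d2E; rewrite d2E in d2.
Qed.

End Stability.

(** The key step: [x] is an eigenvector, for the eigenvalue [c], of the
    endomorphism T which sends [x] to the component of [eps (alpha x)] in the
    second summand of the decomposition of V(1) as the direct sum of alpha V(2)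
    and eps^2 alpha V(2), the latter being identified with V(2). *)
Lemma exists_alpha_eq_eps_sub_eps2 (K : closedFieldType) (V : hmod K) :
  defect_stable V ->
  (1 < \dim {:sp2 V})%N ->
  exists (x y : sp2 V) (c : K), x != 0 /\
    alpha V y = eps V (alpha V x) - c *: eps V (eps V (alpha V x)).
Proof.
move=> stableV d2.
pose e2a := (eps V \o eps V \o alpha V)%VF.
have e2aE x : e2a x = eps V (eps V (alpha V x)) by rewrite !comp_lfunE.
have ker_a : lker (alpha V) == 0%VS.
  rewrite -subv0; apply/subvP=> x.
  by rewrite memv_ker memv0 => /eqP/(stable_alpha_eq0 stableV)/eqP.
have ker_e2a : lker e2a == 0%VS.
  rewrite -subv0; apply/subvP=> x.
  by rewrite memv_ker memv0 e2aE => /eqP/(stable_eps2_alpha_eq0 stableV d2)/eqP.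
(* A common element satisfies alpha y = eps^2 (alpha x), so eps^2 kills
   alpha y because eps^4 = 0. *)
have direct : (limg e2a :&: limg (alpha V) = 0)%VS.
  apply/eqP; rewrite -subv0; apply/subvP=> v /memv_capP[].
  move=> /memv_imgP[x _ ->] /memv_imgP[y _]; rewrite e2aE memv0 => xy.
  suff /(stable_eps2_alpha_eq0 stableV d2) y0 : eps V (eps V (alpha V y)) = 0.
    by rewrite xy y0 linear0.
  by rewrite -xy; apply: (eps_nilp (alpha V x)).
have full : (limg e2a + limg (alpha V) = fullv)%VS.
  apply/eqP; rewrite eqEdim subvf dimv_disjoint_sum // (stable_dim stableV).
  rewrite !limg_dim_eq ?(eqP ker_a) ?(eqP ker_e2a) ?capv0 //.
  by rewrite mul2n addnn leqnn.
pose pi_e2a := daddv_pi (limg e2a) (limg (alpha V)).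
pose T := (e2a^-1 \o (pi_e2a \o (eps V \o alpha V)))%VF.
have [c [x [x0 Tx]]] := closed_field_eigenvector T (stable_dim2_neq0 stableV).
set v := eps V (alpha V x).
have /memv_imgP[y _ yE] := memv_pi (limg (alpha V)) (limg e2a) v.
exists x, y, c; split => //.
have v_in : v \in (limg e2a + limg (alpha V))%VS by rewrite full memvf.
have e2aT : e2a (T x) = pi_e2a v.
  by rewrite /T comp_lfunE limg_lfunVK comp_lfunE ?memv_pi // comp_lfunE.
apply/eqP; rewrite -yE eq_sym subr_eq addrC -e2aE -linearZ -Tx /= e2aT.
by rewrite (daddv_pi_add direct v_in).
Qed.

(** * The two cases of the classification *)

(** Apply powers of [f] to the relation. If a = 0, then f^4 v = b^3 f v, so
    that b = 0. Otherwise applying f^3 gives f^3 v = 0, and then applying f^2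
    gives f^2 v = 0. *)
Lemma nilpotent_quadratic_relation (K : fieldType) (vT : vectType K)
    (f : 'End(vT)) (v : vT) (a b : K) :
  iter 4 f v = 0 -> f v != 0 -> f (f v) = a *: v + b *: f v -> f (f v) = 0.
Proof.
move=> /= f4 fv0 f2.
have f3 : f (f (f v)) = a *: f v + b *: f (f v).
  by rewrite [LHS](congr1 f f2) linearD !linearZ.
have f4E : a *: f (f v) + b *: f (f (f v)) = 0.
  by rewrite -[RHS]f4 [RHS](congr1 f f3) linearD !linearZ.
have f5E : a *: f (f (f v)) = 0.
  by have := congr1 f f4E; rewrite linearD !linearZ /= f4 scaler0 addr0 linear0.
have [a0 | a_neq0] := eqVneq a 0.
  move: f4E; rewrite f3 f2 a0 !scale0r !add0r !scalerA => /eqP.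
  rewrite scaler_eq0 (negPf fv0) orbF !mulf_eq0 !orbb => /eqP ->.
  by rewrite scale0r.
move: f5E f4E => /eqP; rewrite scaler_eq0 (negPf a_neq0) => /eqP ->.
by rewrite scaler0 addr0 => /eqP; rewrite scaler_eq0 (negPf a_neq0) => /eqP.
Qed.

(** The bases are (w, eps w) and (y), where [y] is any non-zero vector of the
    line V(2) and w = alpha y; if eps w were a multiple of w, then w and y
    would span a submodule of defect 1. *)
Lemma iso_V_inf (K : fieldType) (V : hmod K) :
  defect_stable V -> \dim {:sp2 V} = 1%N -> hmod_iso V (V_inf K).
Proof.
move=> stableV d2.
have d1 : \dim {:sp1 V} = 2%N by rewrite stable_dim ?d2.
pose y := vpick {:sp2 V}.
have y0 : y != 0 by rewrite vpick0 -dimv_eq0 d2.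
pose w := alpha V y; set e := eps V.
have w0 : w != 0 by apply: contra y0 => /eqP/(stable_alpha_eq0 stableV)/eqP.
have w_ew : e w \notin <[w]>%VS.
  apply/negP=> ew.
  have [] := @stable_span_basis _ _ stableV [:: w] [:: y].
  - by rewrite seq1_free.
  - by [].
  - by [].
  - by move=> z; rewrite inE => /eqP ->; rewrite memv_span ?mem_head.
  - by move=> z; rewrite inE => /eqP ->; rewrite span_seq1.
  by move=> /size_basis; rewrite d1.
have free1 : free [:: e w; w].
  by rewrite free_cons seq1_free w0 span_seq1 w_ew.
have basis1 : basis_of fullv [tuple w; e w].
  rewrite basisEfree subvf d1 leqnn !andbT.
  rewrite (perm_free (_ : perm_eq _ [:: e w; w])) //.
  by rewrite (perm_catC [:: w] [:: e w]).
have basis2 : basis_of fullv [tuple y].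
  by rewrite basisEfree subvf d2 seq1_free y0.
have eew0 : e (e w) = 0.
  have : e (e w) \in <<[:: w; e w]>>%VS by rewrite (span_basis basis1) memvf.
  rewrite span_cons span_seq1.
  case/memv_addP=> _ /vlineP[a ->] [_ /vlineP[b ->] eew].
  have ew0 : e w != 0 by apply: contraNneq w_ew => ->; rewrite mem0v.
  exact: nilpotent_quadratic_relation (eps_nilp w) ew0 eew.
apply: hmod_iso_of_bases basis1 basis2 _ _.
- move=> j; rewrite !big_ord_recl big_ord0 !mxE.
  by case: j => [[|//] ?]; rewrite /= scale1r scale0r !addr0.
- move=> j; rewrite !big_ord_recl big_ord0 !mxE.
  by case: j => [[|[|//]] ?]; rewrite /= ?scale1r ?scale0r ?addr0 ?add0r.
Qed.

(** The bases in which [V] becomes V_lambda, for lambda = - c, are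
    (w, eps w, eps^2 w, eps^3 w) and (x, y), where w = alpha x and [x], [y], [c]
    come from [exists_alpha_eq_eps_sub_eps2]. *)
Lemma iso_V_lambda (K : closedFieldType) (V : hmod K) :
  defect_stable V -> (1 < \dim {:sp2 V})%N ->
  exists lambda : K, hmod_iso V (V_lambda lambda).
Proof.
move=> stableV d2.
have [x [y [c [x0 yE]]]] := exists_alpha_eq_eps_sub_eps2 stableV d2.
exists (- c).
pose w := alpha V x; set e := eps V in yE *.
(* If y = k x then eps w = k w + c eps^2 w, so that the span of w and eps^2 w
   is stable under eps and yields a submodule with a line at vertex 2. *)
have free2 : free [:: y; x].
  rewrite free_cons seq1_free x0 span_seq1 andbT.
  apply/negP=> /vlineP[k yk].
  have ewE : e w = k *: w + c *: e (e w).
    have <- : alpha V y = k *: w by rewrite yk linearZ.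
    by rewrite yE addrNK.
  have mem0 : w \in <<[:: w; e (e w)]>>%VS by rewrite memv_span ?mem_head.
  have mem2 : e (e w) \in <<[:: w; e (e w)]>>%VS.
    by rewrite memv_span // !inE eqxx orbT.
  have [] := @stable_span_basis _ _ stableV [:: w; e (e w)] [:: x].
  - by rewrite seq1_free.
  - by [].
  - by [].
  - by move=> z; rewrite inE => /eqP ->.
  - move=> z; rewrite !inE => /orP[] /eqP ->.
      by rewrite -/e [X in X \in _]ewE rpredD // rpredZ.
    rewrite -/e [X in X \in _](congr1 (fun z => e (e z)) ewE).
    rewrite !linearD !linearZ /=.
    by rewrite [e (e (e (e w)))](eps_nilp w) scaler0 addr0 rpredZ.
  by move=> _ /size_basis dE; rewrite dE in d2.
have [] := @stable_span_basis _ _ stableV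
  [tuple w; e w; e (e w); e (e (e w))] [tuple x; y].
- by rewrite (perm_free (_ : perm_eq _ [:: y; x])) // (perm_catC [:: x] [:: y]).
- by [].
- by [].
- move=> z; rewrite !inE => /orP[] /eqP ->.
    by rewrite memv_span ?mem_head.
  by rewrite yE rpredB ?rpredZ // memv_span // !inE eqxx ?orbT.
- move=> z; rewrite !inE -/e => /or4P[] /eqP ->.
  1-3: by rewrite memv_span // !inE eqxx ?orbT.
  by rewrite [e (e (e (e w)))](eps_nilp w) mem0v.
move=> basis1 basis2; apply: hmod_iso_of_bases basis1 basis2 _ _.
- move=> j; rewrite !big_ord_recl big_ord0 !mxE.
  case: j => [[|[|//]] ?]; rewrite /= ?scale1r ?scale0r ?addr0 ?add0r //.
  by rewrite yE scaleNr.
- move=> j; rewrite !big_ord_recl big_ord0 !mxE.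
  case: j => [[|[|[|[|//]]]] ?]; rewrite /= ?scale1r ?scale0r ?addr0 ?add0r //.
  exact: eps_nilp.
Qed.

Unset Implicit Arguments.

Theorem theorem1p4 (K : closedFieldType) (charK0 : [pchar K] =i pred0)
  (V : hmod K) (stableV : defect_stable V) :
  hmod_iso V (V_inf K) \/ exists lambda : K, hmod_iso V (V_lambda lambda).
Proof.
have [d2 | ] := eqVneq (\dim {:sp2 V}) 1%N.
  by left; apply: iso_V_inf.
move=> d2; right; apply: iso_V_lambda => //.
by rewrite ltn_neqAle eq_sym d2 lt0n (stable_dim2_neq0 stableV).
Qed.
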